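(* Let $d=d(n)=o(n)$, let $G$ be a $d$-regular simple graph on $n$ vertices, let $0\le l\le n$, let $S$ be a uniformly random subset of the vertex set of size $l$, and let $T=T(S)$ be the number of edges of $G$ with one endpoint in $S$ and the other in $S^c$. Then for every $\gamma\in\mathbb{R}$ with $2|\gamma|\sqrt{4nd(1+o(1))}<1$, $$\log\mathbb{E}\exp\big(\gamma(T-\mathbb{E}T)\big)\le\frac{32nd\gamma^2(1+o(1))}{1-16nd\gamma^2(1+o(1))}.$$
   Context: The $o(1)$ terms tend to $0$ as $n\to\infty$ (under $d=o(n)$), uniformly in $\gamma$ and $l$. *)

(* Defs.v *)
From HB Require Import structures.
From mathcomp Require Import all_boot all_order all_algebra.
From mathcomp Require Import all_classical all_reals all_analysis.

Set Implicit Arguments.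
Unset Strict Implicit.
Unset Printing Implicit Defensive.

Import Order.TTheory GRing.Theory Num.Theory.
Import numFieldNormedType.Exports.

Local Open Scope ring_scope.

Record sgraph (V : finType) := SGraph {
  adj : rel V;
  adj_sym : symmetric adj;
  adj_irr : irreflexive adj
}.

Definition regular (V : finType) (G : sgraph V) (k : nat) : Prop :=
  forall v : V, #|[set u : V | adj G v u]| = k.

(* Edges are unordered pairs: each edge is the two-element set of its
   endpoints, so that it is counted once although [adj G] is symmetric. *)
Definition edges (V : finType) (G : sgraph V) : {set {set V}} :=
  [set [set p.1; p.2] | p : V * V & adj G p.1 p.2].

Definition cut_size (V : finType) (G : sgraph V) (S : {set V}) : nat :=
  #|[set f in edges G | (#|f :&: S| == 1)%N && (#|f :&: ~: S| == 1)%N]|.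

(* Expectation of [X S] for [S] uniform among the subsets of [V] of size [l];
   meaningful for l <= #|V|, where this family is nonempty. *)
Definition expect_subset (R : realType) (V : finType) (l : nat)
    (X : {set V} -> R) : R :=
  (\sum_(S : {set V} | #|S| == l) X S) / #|[set S : {set V} | #|S| == l]|%:R.

(* Main.v *)
Require Import Defs.
From HB Require Import structures.
From mathcomp Require Import all_boot all_order all_algebra.
From mathcomp Require Import all_classical all_reals all_analysis.
From mathcomp Require Import ring lra.

Set Implicit Arguments.
Unset Strict Implicit.
Unset Printing Implicit Defensive.

Import Order.TTheory GRing.Theory Num.Theory.
Import numFieldNormedType.Exports.

Local Open Scope classical_set_scope.
Local Open Scope ring_scope.

(** The inequality holds for every [n] with all three error terms equal to [0].
It is proved with the method of exchangeable pairs for the random transposition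
walk on the [l]-subsets, whose moves exchange a vertex of [S] with a vertex
outside [S]; this walk is reversible for the uniform measure.

Write [n] for the number of vertices, [k] for the degree, [h] for
[gamma (T - E T)], [m] for [E exp h] and [D] for [E (h exp h)].
- Since [G] is regular, [T - E T] is an eigenfunction of the walk: summing
  [T S - T S'] over all moves [S -> S'] gives [2 (n - 1) (T S - E T)]
  ([expect_cut_size_eigen]).  By reversibility and the trapezoid inequality for
  [exp], [2 (n - 1) D] is therefore at most half of the expectation of [exp h]
  times the sum of [(h S - h S')^2] over all moves ([dirichlet_le]).
- This sum of squares is at most [gamma^2 (8 n g + 8 n k)], where [g S] is the
  sum over all vertices of the squared deviation of the number of neighbours in
  [S] from its mean ([irregularity], [sum_sqr_cut_size_swap]).  It is random,
  and the trivial bound [n k^2] for [g] is too weak by a factor [k].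
- The Gibbs variational inequality ([gibbs]) decouples [g] from [exp h]: with
  [c = 1 / (4 n k)], [c E (g exp h) <= m (ln (E exp (c g)) - ln m) + D].
- The exponential moment of [g] comes from the same method applied to [g]: the
  walk pulls [g] down at rate [2 n] up to a constant
  ([sum_irregularity_swap]), and the squared increments of [g] are controlled by
  [g] itself ([sum_sqr_irregularity_swap]), which gives
  [ln (E exp (c g)) <= 5 / 16] ([ln_mgf_irregularity_le]).

Together, [D (1 - 16 n k gamma^2) <= 7 n k gamma^2 m].  No differential
inequality has to be integrated, because [ln m <= D / m] by convexity
([ln_mgf_le]). *)

(** * The trapezoid inequality for the exponential *)

Lemma expR_trapezoid_ge0 (R : realType) (z : R) :
  0 <= z -> (2 - z) * expR z <= 2 + z.
Proof.
move=> z0; pose f (t : R) : R := (2 - t) * expR t - t.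
have df t : is_derive t (1 : R) f ((1 - t) * expR t - 1).
  rewrite /f; apply: is_derive_eq.
  by rewrite /GRing.scale /=; ring.
have [z00|zn0] := eqVneq z 0; first by rewrite z00 expR0; lra.
have zp : 0 < z by rewrite lt_neqAle eq_sym zn0.
have cf : {within `[0, z], continuous f}.
  apply: derivable_within_continuous => x _.
  by have [] := df x.
have [c] := MVT zp (fun x _ => df x) cf.
rewrite in_itv /= => /andP[c0 _]; rewrite /f expR0 => e.
have : (1 - c) * expR c - 1 <= 0.
  have : (1 + (- c)) * expR c <= expR (- c) * expR c.
    by rewrite ler_pM2r ?expR_gt0// expR_ge1Dx.
  by rewrite -expRD addNr expR0; lra.
move: e; set q := _ - 1 => e q0.
have : q * (z - 0) <= 0 by rewrite mulr_le0_ge0// subr0.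
rewrite -e; lra.
Qed.

(** The trapezoid rule overestimates the integral of the convex function [expR];
bounding the integrand by its value at the larger endpoint instead would lose a
factor [2] in the comparison of Dirichlet forms. *)
Lemma expR_trapezoid (R : realType) (x y : R) :
  (x - y) * (expR x - expR y) <= (x - y) ^+ 2 * (expR x + expR y) / 2.
Proof.
wlog yx : x y / y <= x.
  move=> W; have [yx|/ltW xy] := leP y x; first exact: W. have := W _ _ xy.
  lra.
have z0 : 0 <= x - y by rewrite subr_ge0.
have := expR_trapezoid_ge0 z0.
rewrite -(ler_pM2r (expR_gt0 y)) -[_ * _ * expR y]mulrA -expRD subrK => H.
have : (x - y) * ((2 - (x - y)) * expR x) <= (x - y) * ((2 + (x - y)) * expR y).
  by rewrite ler_wpM2l.
lra.
Qed.

(** * Exponential moments over the subsets of a given size *)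

Section Expectation.
Context {R : realType} {V : finType} (l : nat).
Implicit Types (X Y : {set V} -> R) (S : {set V}).
Local Notation E := (@expect_subset R V l).

Lemma expectD X Y : E (fun S => X S + Y S) = E X + E Y.
Proof. by rewrite /expect_subset big_split mulrDl. Qed.

Lemma expectZ a X : E (fun S => a * X S) = a * E X.
Proof. by rewrite /expect_subset -mulr_sumr mulrA. Qed.

Lemma eq_expect X Y : (forall S, #|S| = l -> X S = Y S) -> E X = E Y.
Proof.
by move=> XY; rewrite /expect_subset; congr (_ / _); apply: eq_bigr => S /eqP /XY.
Qed.

Lemma le_expect X Y : (forall S, #|S| = l -> X S <= Y S) -> E X <= E Y.
Proof.
move=> XY; rewrite /expect_subset ler_wpM2r ?invr_ge0//.
by apply: ler_sum => S /eqP /XY.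
Qed.

Hypothesis lV : (l <= #|V|)%N.

Lemma expect1 : E (fun=> 1) = 1.
Proof.
have -> : E (fun=> 1) = #|[set S : {set V} | #|S| == l]%SET|%:R
    / #|[set S : {set V} | #|S| == l]%SET|%:R.
  rewrite /expect_subset -sum1_card natr_sum; congr (_ / _).
  by apply: eq_bigl => S; rewrite inE.
by rewrite divff// pnatr_eq0 card_draws -lt0n bin_gt0.
Qed.

Lemma expect_cst a : E (fun=> a) = a.
Proof.
rewrite -[RHS]mulr1 -expect1 -expectZ.
by apply: eq_expect => S _; rewrite mulr1.
Qed.

Lemma expect_gt0 X : (forall S, 0 < X S) -> 0 < E X.
Proof.
move=> X0; rewrite /expect_subset divr_gt0//; last first.
  by rewrite ltr0n card_draws bin_gt0.
have [S0 S0l] : exists S0 : {set V}, #|S0| == l.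
  have : (0 < #|[set S : {set V} | #|S| == l]%SET|)%N by rewrite card_draws bin_gt0.
  by case/card_gt0P => S; rewrite inE; exists S.
rewrite (bigD1 S0)//= ltr_wpDr//.
by apply: sumr_ge0 => S _; exact: ltW.
Qed.

(** The Gibbs variational principle: under the probability measure of density
[expR X / m], the mean of [Y] is at most the logarithmic moment generating
function of [Y] plus the relative entropy of that measure.  It follows from
[1 + t <= expR t] at [t = Y - X + k], where the shift [k] makes the integrated
inequality tight. *)
Lemma gibbs X Y :
  E (fun S => expR (X S) * Y S)
  <= E (fun S => expR (X S))
       * (ln (E (fun S => expR (Y S))) - ln (E (fun S => expR (X S))))
     + E (fun S => X S * expR (X S)).
Proof.
set m := E (fun S => expR (X S)); set M := E (fun S => expR (Y S)).
have m0 : 0 < m by apply: expect_gt0 => S; exact: expR_gt0.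
have M0 : 0 < M by apply: expect_gt0 => S; exact: expR_gt0.
pose k := ln m - ln M.
have Mk : M * expR k = m by rewrite expRB !lnK// mulrC divfK// gt_eqF.
have : E (fun S => expR (X S) + (expR (X S) * Y S + (-1 * (X S * expR (X S))
          + k * expR (X S)))) <= E (fun S => expR k * expR (Y S)).
  apply: le_expect => S _.
  have := expR_ge1Dx (Y S - X S + k).
  rewrite -(ler_pM2l (expR_gt0 (X S))) => H.
  have -> : expR k * expR (Y S) = expR (X S) * expR (Y S - X S + k).
    by rewrite -!expRD; congr expR; ring.
  by apply: le_trans H; rewrite le_eqVlt; apply/orP; left; apply/eqP; ring.
rewrite !expectD !expectZ -/m -/M [expR k * M]mulrC Mk /k; lra.
Qed.

(** Nonnegativity of the entropy of [expR X], that is [gibbs] with [Y = 0]. *)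
Lemma ln_mgf_le X :
  ln (E (fun S => expR (X S))) <=
  E (fun S => X S * expR (X S)) / E (fun S => expR (X S)).
Proof.
have m0 : 0 < E (fun S => expR (X S)) by apply: expect_gt0 => S; exact: expR_gt0.
rewrite ler_pdivlMr// -subr_ge0.
have := gibbs X (fun=> 0).
have -> : E (fun S => expR (X S) * 0) = 0.
  by rewrite -[RHS](expect_cst 0); apply: eq_expect => S _; rewrite mulr0.
by rewrite expR0 expect1 ln1 sub0r; lra.
Qed.

Lemma ln_mgf_ge0 X : E X = 0 -> 0 <= ln (E (fun S => expR (X S))).
Proof.
move=> EX; apply: ln_ge0.
have : E (fun S => 1 + X S) <= E (fun S => expR (X S)).
  by apply: le_expect => S _; exact: expR_ge1Dx.
by rewrite expectD expect1 EX addr0.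
Qed.

End Expectation.

(** * The random transposition walk *)

Section Swap.
Context {R : realType} {V : finType}.
Implicit Types (S : {set V}) (u v w : V) (p : V * V).

(** The move of the walk along [p = (u, v)] replaces [u] by [v]; it is a move of
the walk when [swappable S p] holds. *)
Definition swap S p : {set V} := (p.2 |: (S :\ p.1))%SET.

Definition swappable S p : bool := (p.1 \in S) && (p.2 \notin S).

Definition memR S v : R := (v \in S)%:R.

Lemma memR_swap S p w : swappable S p ->
  memR (swap S p) w = memR S w - (w == p.1)%:R + (w == p.2)%:R.
Proof.
case: p => u v /andP[/= uS vS]; rewrite /memR /swap !inE /=.
have uv : u != v by apply: contra vS => /eqP <-.
have [->|wv] := eqVneq w v; first by rewrite eq_sym (negbTE uv) (negbTE vS); lra.
by have [->|wu] := eqVneq w u; rewrite ?uS/=; lra.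
Qed.

Lemma swapK S p : swappable S p -> swap (swap S p) (p.2, p.1) = S.
Proof.
case: p => u v /andP[/= uS vS]; apply/setP => w; rewrite !inE /=.
have uv : u != v by apply: contra vS => /eqP <-.
have [->|wu] := eqVneq w u; first by rewrite uS.
by have [->|wv] := eqVneq w v; rewrite ?(negbTE vS).
Qed.

Lemma swappable_swap S p :
  swappable S p -> swappable (swap S p) (p.2, p.1).
Proof.
case: p => u v /andP[/= uS vS]; rewrite /swappable /swap !inE /= !eqxx /= orbF.
by apply: contra vS => /eqP <-.
Qed.

Lemma card_swap S p : swappable S p -> #|swap S p| = #|S|.
Proof.
case: p => u v /andP[/= uS vS].
by rewrite /swap cardsU1 !inE /= (negbTE vS) andbF [RHS](cardsD1 u) uS.
Qed.

(** Reversibility: [(S, (u, v)) |-> (swap S (u, v), (v, u))] is an involution of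
the set of moves that preserves the size of [S]. *)
Lemma expect_swap_sym (l : nat) (F : {set V} -> {set V} -> R) :
  expect_subset l (fun S => \sum_(p | swappable S p) F S (swap S p)) =
  expect_subset l (fun S => \sum_(p | swappable S p) F (swap S p) S).
Proof.
rewrite /expect_subset; congr (_ / _); rewrite !pair_big_dep /=.
pose s (q : {set V} * (V * V)) := (swap q.1 q.2, (q.2.2, q.2.1)).
rewrite (reindex_onto s s) /=; last first.
  by move=> [S [u v]] /andP[/= _ H]; rewrite /s/= (swapK H).
apply: eq_big => [[S [u v]]|[S [u v]] /=] /=.
  apply/idP/idP => [/andP[/andP[/eqP Sl H] /eqP]|/andP[/eqP Sl H]].
    rewrite /s /= => -[K].
    have := swappable_swap H; rewrite /= K => ->.
    by have := card_swap H; rewrite K => ->; rewrite Sl eqxx.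
  by rewrite /s /= (swapK H) card_swap// Sl eqxx eqxx swappable_swap.
by move=> /andP[_ /eqP]; rewrite /s /= => -[->].
Qed.

(** Symmetrizing the left-hand side by reversibility turns it into half of the
sum of [(X S - X S') (expR (X S) - expR (X S'))], to which the trapezoid
inequality applies; symmetrizing back merges the two exponentials. *)
Lemma dirichlet_le (l : nat) (X : {set V} -> R) :
  expect_subset l (fun S => \sum_(p | swappable S p)
     (X S - X (swap S p)) * expR (X S)) <=
  expect_subset l (fun S => expR (X S) * \sum_(p | swappable S p)
     (X S - X (swap S p)) ^+ 2) / 2.
Proof.
pose F S S' := (X S - X S') * expR (X S).
pose H S S' := (X S - X S') ^+ 2 * expR (X S).
have eF := expect_swap_sym l F.
have eH := expect_swap_sym l H.
have -> : expect_subset l (fun S => expR (X S) * \sum_(p | swappable S p)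
     (X S - X (swap S p)) ^+ 2) =
   expect_subset l (fun S => \sum_(p | swappable S p) H S (swap S p)).
  by apply: eq_expect => S _; rewrite mulr_sumr; apply: eq_bigr => p _; rewrite mulrC.
have : expect_subset l (fun S => \sum_(p | swappable S p) F S (swap S p) +
          \sum_(p | swappable S p) F (swap S p) S) <=
       expect_subset l (fun S => 2^-1 * (\sum_(p | swappable S p) H S (swap S p)
          + \sum_(p | swappable S p) H (swap S p) S)).
  apply: le_expect => S _; rewrite -!big_split mulr_sumr.
  apply: ler_sum => p _ /=; rewrite /F /H.
  have := expR_trapezoid (X S) (X (swap S p)); lra.
rewrite expectD expectZ expectD -eF -eH; lra.
Qed.

Lemma sum_swappable S (F : V -> V -> R) :
  \sum_(p | swappable S p) F p.1 p.2 =
  \sum_u \sum_v memR S u * (1 - memR S v) * F u v.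
Proof.
rewrite pair_big /= big_mkcond; apply: eq_bigr => -[u v] _ /=.
rewrite /swappable /memR /=.
by case: (u \in S); case: (v \in S) => /=; lra.
Qed.

Lemma sum_memR S : \sum_v memR S v = #|S|%:R.
Proof.
by rewrite -sum1_card natr_sum [RHS]big_mkcond; apply: eq_bigr => v _; rewrite /memR; case: ifP.
Qed.

End Swap.

Section SwapSums.
Context {R : realType} {V : finType}.
Implicit Types (S : {set V}) (a z : V -> R).

Lemma sum_swap_src S a :
  \sum_(p | swappable S p) a p.1 = (#|V|%:R - #|S|%:R) * \sum_u memR S u * a u.
Proof.
rewrite (sum_swappable S (fun u _ => a u)) mulr_sumr; apply: eq_bigr => u _.
rewrite -cardsT -(sum_memR S) -(sum_memR [set: V]%SET) -sumrB mulr_suml.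
apply: eq_bigr => v _. have -> : memR [set: V]%SET v = 1 :> R by rewrite /memR inE. ring.
Qed.

Lemma sum_swap_dst S a :
  \sum_(p | swappable S p) a p.2 = #|S|%:R * \sum_v (1 - memR S v) * a v.
Proof.
rewrite (sum_swappable S (fun _ v => a v)) exchange_big mulr_sumr.
by apply: eq_bigr => v _; rewrite /= -sum_memR mulr_suml; apply: eq_bigr => u _; ring.
Qed.

Lemma sum_const_type (b : R) : \sum_(v : V) b = #|V|%:R * b.
Proof. by rewrite sumr_const mulr_natl. Qed.

Lemma sum_swappable_cst S (c : R) :
  \sum_(p | swappable S p) c = #|S|%:R * (#|V|%:R - #|S|%:R) * c.
Proof.
rewrite (sum_swap_src S (fun=> c)) -mulr_suml sum_memR; lra.
Qed.

(** The moves of the walk select one orientation of some of the pairs of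
vertices, and over all ordered pairs the squared differences add up to at most
[2 n] times the sum of squares. *)
Lemma swap_poincare S z :
  \sum_(p | swappable S p) (z p.2 - z p.1) ^+ 2 <= #|V|%:R * \sum_v z v ^+ 2.
Proof.
rewrite (sum_swappable S (fun u v => (z v - z u) ^+ 2)).
set D := (X in X <= _).
have eD : D = \sum_u \sum_v memR S v * (1 - memR S u) * (z v - z u) ^+ 2.
  rewrite /D exchange_big; apply: eq_bigr => u _; apply: eq_bigr => v _ /=.
  by ring.
have : D + D <= \sum_u \sum_v (z v - z u) ^+ 2.
  rewrite {2}eD -big_split; apply: ler_sum => u _ /=; rewrite -big_split.
  apply: ler_sum => v _ /=.
  have := sqr_ge0 (z v - z u); rewrite /memR.
  by case: (u \in S); case: (v \in S) => /=; lra.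
have -> : \sum_u \sum_v (z v - z u) ^+ 2 =
    #|V|%:R * (\sum_v z v ^+ 2) * 2 - 2 * (\sum_v z v) ^+ 2.
  transitivity (\sum_u ((\sum_v z v ^+ 2) + (#|V|%:R * z u ^+ 2
      - 2 * (\sum_v z v) * z u))).
    apply: eq_bigr => u _; rewrite -sum_const_type -mulrA mulr_suml mulr_sumr -sumrB.
    by rewrite -big_split; apply: eq_bigr => v _ /=; ring.
  by rewrite big_split sumrB -!mulr_sumr sum_const_type /=; ring.
have := sqr_ge0 (\sum_v z v); lra.
Qed.

End SwapSums.

(** * Cuts and neighbour counts of a regular graph *)

Section Cut.
Context {R : realType} {V : finType} (G : sgraph V) (k : nat).
Hypothesis regG : regular G k.
Implicit Types (S : {set V}) (u v w : V) (p : V * V).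

Definition adjR u v : R := (adj G u v)%:R.

Definition nbr_count S v : R := \sum_w adjR v w * memR S w.

Lemma adjRC u v : adjR u v = adjR v u.
Proof. by rewrite /adjR adj_sym. Qed.

Lemma adjRxx u : adjR u u = 0.
Proof. by rewrite /adjR adj_irr. Qed.

Lemma adjR_ge0 u v : 0 <= adjR u v.
Proof. exact: ler0n. Qed.

Lemma adjR_sqr u v : adjR u v ^+ 2 = adjR u v.
Proof. by rewrite /adjR; case: (adj _ _ _); rewrite ?expr1n ?expr0n. Qed.

Lemma sum_adjR v : \sum_w adjR v w = k%:R.
Proof.
rewrite -(regG v) -sum1_card natr_sum [RHS]big_mkcond; apply: eq_bigr => w _.
by rewrite inE /adjR; case: ifP.
Qed.

Lemma nbr_count_ge0 S v : 0 <= nbr_count S v.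
Proof. by apply: sumr_ge0 => w _; rewrite mulr_ge0 ?adjR_ge0 ?ler0n. Qed.

Lemma nbr_count_le S v : nbr_count S v <= k%:R.
Proof.
rewrite -(sum_adjR v); apply: ler_sum => w _; have := adjR_ge0 v w.
by rewrite /memR; case: (w \in S) => /=; lra.
Qed.

Lemma nbr_count_swap S p w : swappable S p ->
  nbr_count (swap S p) w = nbr_count S w - adjR w p.1 + adjR w p.2.
Proof.
move=> H; have pick q : \sum_x adjR w x * (x == q)%:R = adjR w q.
  rewrite (bigD1 q)//= eqxx mulr1 big1 ?addr0// => x /negbTE ->.
  by rewrite mulr0.
rewrite -(pick p.1) -(pick p.2) /nbr_count -sumrB -big_split; apply: eq_bigr => x _ /=.
by rewrite memR_swap//; ring.
Qed.

(** A cut edge is the unordered pair of exactly one move [(u, v)] with [u] and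
[v] adjacent: its end in [S] comes first. *)
Lemma cut_size_sum S :
  (cut_size G S)%:R = \sum_(p | swappable S p) adjR p.1 p.2.
Proof.
pose C := [set p : V * V | swappable S p && adj G p.1 p.2]%SET.
pose e p : {set V} := [set p.1; p.2]%SET.
have meet1 (B : {set V}) u v : u \in B -> v \notin B -> ([set u; v] :&: B = [set u])%SET.
  move=> uB vB; apply/setP => w; rewrite !inE.
  have [->|wu] := eqVneq w u; first by rewrite uB.
  by have [->|] := eqVneq w v; rewrite ?(negbTE vB).
have meet2 (B : {set V}) u v : u \notin B -> v \in B -> ([set u; v] :&: B = [set v])%SET.
  by rewrite finset.setUC => uB vB; exact: meet1.
have eI : {in C &, injective e}.
  move=> [u v] [u' v']; rewrite !inE /swappable /e /=.
  move=> /andP[/andP[uS vS] _] /andP[/andP[u'S v'S] _] E.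
  have /setP/(_ u') := congr1 (fun X => X :&: S)%SET E.
  have /setP/(_ v') := congr1 (fun X => X :&: ~: S)%SET E.
  rewrite !(meet1 S)// !(meet2 (~: S)%SET) ?inE ?negbK//.
  by rewrite !eqxx => /eqP <- /eqP <-.
have -> : cut_size G S = #|C|.
  rewrite -(card_in_imset eI) /cut_size; apply: eq_card => f.
  rewrite inE; apply/idP/imsetP.
    move=> /andP[/imsetP[[u v]]]; rewrite inE /= => uv -> {f}.
    have [uS|uS] := boolP (u \in S); have [vS|vS] := boolP (v \in S).
    - have /finset.setIidPl -> : [set u; v]%SET \subset S.
        by apply/fintype.subsetP => w; rewrite !inE => /orP[]/eqP->.
      rewrite cards2; have [E|_] := eqVneq u v; last by move=> /andP[].
      by move: uv; rewrite E adj_irr.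
    - by move=> _; exists (u, v); rewrite // inE /swappable /= uS vS.
    - move=> _; exists (v, u); last by rewrite /e /= finset.setUC.
      by rewrite inE /swappable /= vS uS adj_sym.
    - have /finset.setIidPl -> : [set u; v]%SET \subset (~: S)%SET.
        by apply/fintype.subsetP => w; rewrite !inE => /orP[]/eqP->.
      rewrite cards2; have [E|_] := eqVneq u v; last by move=> /andP[].
      by move: uv; rewrite E adj_irr.
  move=> [[u v]]; rewrite inE /swappable /e /= => /andP[/andP[uS vS] uv] ->.
  rewrite (meet1 S)// (meet2 (~: S)%SET) ?inE ?negbK// !cards1 !eqxx !andbT.
  by apply/imsetP; exists (u, v); rewrite ?inE.
rewrite -sum1_card natr_sum big_mkcond [RHS]big_mkcond; apply: eq_bigr => p _.
by rewrite inE /adjR; case: swappable => //=; case: adj.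
Qed.

Lemma cut_sizeE S :
  (cut_size G S)%:R = k%:R * #|S|%:R - \sum_v memR S v * nbr_count S v.
Proof.
rewrite cut_size_sum (sum_swappable S adjR) -(sum_memR S) mulr_sumr -sumrB.
apply: eq_bigr => u _; rewrite -(sum_adjR u) mulr_suml mulr_sumr -sumrB.
by apply: eq_bigr => v _; ring.
Qed.

Lemma sum_nbr_count S : \sum_v nbr_count S v = k%:R * #|S|%:R.
Proof.
rewrite exchange_big -(sum_memR S) mulr_sumr; apply: eq_bigr => u _ /=.
by rewrite -(sum_adjR u) mulr_suml; apply: eq_bigr => v _; rewrite adjRC.
Qed.

Lemma cut_size_le S : (cut_size G S)%:R <= #|V|%:R * k%:R :> R.
Proof.
rewrite cut_sizeE -(sum_memR S) mulr_sumr -sumrB -sum_const_type; apply: ler_sum => v _.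
have := nbr_count_ge0 S v; have := nbr_count_le S v; have : 0 <= k%:R :> R by [].
by rewrite /memR; case: (v \in S) => /=; lra.
Qed.

Lemma cut_size_swap S p : swappable S p ->
  (cut_size G S)%:R - (cut_size G (swap S p))%:R =
  2 * (nbr_count S p.2 - nbr_count S p.1 - adjR p.1 p.2).
Proof.
move=> H; rewrite !cut_sizeE card_swap//.
have pick (F : V -> R) q : \sum_x (x == q)%:R * F x = F q.
  by rewrite (bigD1 q)//= eqxx mul1r big1 ?addr0// => x /negbTE ->; rewrite mul0r.
have -> : \sum_v memR (swap S p) v * nbr_count (swap S p) v =
    \sum_v memR S v * nbr_count S v - \sum_v adjR p.1 v * memR S v
    + \sum_v adjR p.2 v * memR S v
    - \sum_v (v == p.1)%:R * (nbr_count S v - adjR v p.1 + adjR v p.2)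
    + \sum_v (v == p.2)%:R * (nbr_count S v - adjR v p.1 + adjR v p.2).
  rewrite -sumrB -big_split -sumrB -big_split; apply: eq_bigr => v _ /=.
  by rewrite memR_swap// nbr_count_swap// (adjRC p.1) (adjRC p.2); ring.
rewrite (pick (fun v => nbr_count S v - adjR v p.1 + adjR v p.2)).
rewrite (pick (fun v => nbr_count S v - adjR v p.1 + adjR v p.2)).
by rewrite -!/(nbr_count S _) !adjRxx (adjRC p.2 p.1); ring.
Qed.

(** The sum of the increments is affine in the cut size because regularity
turns every sum of neighbour counts over [S] or its complement into an affine
function of the cut size. *)
Lemma sum_cut_size_swap S :
  \sum_(p | swappable S p) ((cut_size G S)%:R - (cut_size G (swap S p))%:R) =
  2 * ((#|V|%:R - 1) * (cut_size G S)%:R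
       - (#|V|%:R - #|S|%:R) * k%:R * #|S|%:R) :> R.
Proof.
rewrite (eq_bigr _ (fun p H => cut_size_swap H)) -mulr_sumr !sumrB.
rewrite -cut_size_sum sum_swap_src sum_swap_dst.
have -> : \sum_v (1 - memR S v) * nbr_count S v = (cut_size G S)%:R.
  rewrite cut_sizeE -sum_nbr_count -sumrB; apply: eq_bigr => v _; ring.
have -> : \sum_v memR S v * nbr_count S v = k%:R * #|S|%:R - (cut_size G S)%:R.
  by rewrite cut_sizeE; ring.
ring.
Qed.

(** The expected number of neighbours of a vertex in a uniformly random set of
size [l]. *)
Definition nbr_mean (l : nat) : R := k%:R * l%:R / #|V|%:R.

Definition irregularity S : R := \sum_w (nbr_count S w - nbr_mean #|S|) ^+ 2.

(** The operator norm of the adjacency matrix is at most the degree, by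
Cauchy-Schwarz in each row. *)
Lemma adjR_contract (y : V -> R) :
  \sum_v (\sum_w adjR v w * y w) ^+ 2 <= k%:R ^+ 2 * \sum_w y w ^+ 2.
Proof.
have cs v : (\sum_w adjR v w * y w) ^+ 2 <= k%:R * \sum_w adjR v w * y w ^+ 2.
  set t := \sum_w _; set q := \sum_w _ * _ ^+ 2.
  have [k0|k0] := eqVneq (k%:R : R) 0.
    have a0 w : adjR v w = 0.
      have := sum_adjR v; rewrite k0 => /eqP.
      by rewrite psumr_eq0 => [/allP/(_ w)/(_ (mem_index_enum _))/eqP|u _];
         rewrite ?adjR_ge0.
    by rewrite k0 mul0r /t big1 ?expr0n// => w _; rewrite a0 mul0r.
  have : 0 <= \sum_w adjR v w * (k%:R * y w - t) ^+ 2.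
    by apply: sumr_ge0 => w _; rewrite mulr_ge0 ?adjR_ge0 ?sqr_ge0.
  have -> : \sum_w adjR v w * (k%:R * y w - t) ^+ 2 = k%:R * (k%:R * q - t ^+ 2).
    transitivity (\sum_w k%:R ^+ 2 * (adjR v w * y w ^+ 2)
        - \sum_w 2 * k%:R * t * (adjR v w * y w) + \sum_w t ^+ 2 * adjR v w).
      by rewrite -sumrB -big_split; apply: eq_bigr => w _ /=; ring.
    by rewrite -!mulr_sumr sum_adjR -/t -/q; ring.
  by rewrite pmulr_rge0 ?subr_ge0// lt_neqAle eq_sym k0 ler0n.
apply: le_trans (ler_sum _ (fun v _ => cs v)) _.
rewrite -mulr_sumr expr2 -mulrA ler_wpM2l// exchange_big mulr_sumr.
rewrite le_eqVlt; apply/orP; left; apply/eqP; apply: eq_bigr => w _ /=.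
by rewrite -mulr_suml -(sum_adjR w); congr (_ * _); apply: eq_bigr => v _; rewrite adjRC.
Qed.

Hypothesis V0 : (0 < #|V|)%N.

Let y S w := nbr_count S w - nbr_mean #|S|.

Lemma irregularity_ge0 S : 0 <= irregularity S.
Proof. by apply: sumr_ge0 => w _; rewrite sqr_ge0. Qed.

Lemma irregularity_swap S p : swappable S p ->
  irregularity S - irregularity (swap S p) =
  - (2 * \sum_w (y S w * (adjR w p.2 - adjR w p.1)))
  - \sum_w (adjR w p.2 - adjR w p.1) ^+ 2.
Proof.
move=> H; rewrite mulr_sumr -sumrB -opprD -big_split -sumrN; apply: eq_bigr => w _ /=.
by rewrite nbr_count_swap// card_swap// /y; ring.
Qed.

Lemma adjR_diff_sqr w u v : (adjR w v - adjR w u) ^+ 2 <= adjR w v + adjR w u.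
Proof.
by rewrite /adjR; case: (adj G w v); case: (adj G w u); rewrite /= !expr2; lra.
Qed.

(** For each vertex the deviation [y] of its neighbour count is an eigenfunction
of the walk with eigenvalue [n], so the cross terms contribute [2 n y ^ 2]; the
squares of the increments of [y] add up to at most [n k] since at most [n k]
moves involve a neighbour of the vertex on one side. *)
Lemma sum_irregularity_swap S :
  2 * #|V|%:R * irregularity S - #|V|%:R ^+ 2 * k%:R <=
  \sum_(p | swappable S p) (irregularity S - irregularity (swap S p)).
Proof.
rewrite (eq_bigr _ (fun p H => irregularity_swap H)) sumrB sumrN -mulr_sumr.
rewrite exchange_big [X in _ <= _ - X]exchange_big /=.
have n0 : #|V|%:R != 0 :> R by rewrite pnatr_eq0 -lt0n.
have dst w : \sum_v (1 - memR S v) * adjR w v = k%:R - nbr_count S w.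
  by rewrite -(sum_adjR w) -sumrB; apply: eq_bigr => v _; ring.
have src w : \sum_v memR S v * adjR w v = nbr_count S w.
  by apply: eq_bigr => v _; ring.
have -> : \sum_w \sum_(p | swappable S p) y S w * (adjR w p.2 - adjR w p.1) =
     - (#|V|%:R * irregularity S).
  rewrite /irregularity mulr_sumr -sumrN; apply: eq_bigr => w _.
  rewrite -mulr_sumr sumrB (sum_swap_src S (adjR w)) (sum_swap_dst S (adjR w)).
  by rewrite dst src /y /nbr_mean; field.
have : \sum_w \sum_(p | swappable S p) (adjR w p.2 - adjR w p.1) ^+ 2
   <= #|V|%:R * (#|V|%:R * k%:R).
  rewrite -sum_const_type; apply: ler_sum => w _.
  apply: (@le_trans _ _ (\sum_(p | swappable S p) (adjR w p.2 + adjR w p.1))).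
    by apply: ler_sum => p _; exact: adjR_diff_sqr.
  rewrite big_split /= (sum_swap_src S (adjR w)) (sum_swap_dst S (adjR w)) dst src.
  have := nbr_count_ge0 S w; have := nbr_count_le S w.
  have : #|S|%:R <= #|V|%:R :> R by rewrite ler_nat max_card.
  have : 0 <= #|S|%:R :> R by [].
  nra.
lra.
Qed.

(** Self-bounding: the linear part of an increment along [(u, v)] is, up to sign,
[2 (z v - z u)] with [z] the image of the deviations under the adjacency
matrix, so [swap_poincare] and [adjR_contract] bound the sum of its squares by a
multiple of [irregularity S] itself.  The quadratic part lies between [0] and
[2 k], and there are at most [n ^ 2 / 4] moves. *)
Lemma sum_sqr_irregularity_swap S :
  \sum_(p | swappable S p) (irregularity S - irregularity (swap S p)) ^+ 2 <=
  8 * #|V|%:R * k%:R ^+ 2 * irregularity S + 2 * #|V|%:R ^+ 2 * k%:R ^+ 2.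
Proof.
pose z v := \sum_w adjR v w * y S w.
apply: (@le_trans _ _ (\sum_(p | swappable S p)
    (8 * (z p.2 - z p.1) ^+ 2 + 8 * k%:R ^+ 2))).
  apply: ler_sum => p H; rewrite irregularity_swap//.
  have -> : \sum_w y S w * (adjR w p.2 - adjR w p.1) = z p.2 - z p.1.
    rewrite /z -sumrB; apply: eq_bigr => w _.
    by rewrite (adjRC p.1) (adjRC p.2); ring.
  set b := \sum_w _ ^+ 2.
  have b0 : 0 <= b by apply: sumr_ge0 => w _; rewrite sqr_ge0.
  have bk : b <= 2 * k%:R.
    apply: le_trans (ler_sum _ (fun w _ => adjR_diff_sqr w p.1 p.2)) _.
    rewrite big_split /=.
    have e v : \sum_w adjR w v = k%:R.
      by rewrite -(sum_adjR v); apply: eq_bigr => w _; rewrite adjRC.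
    rewrite !e; lra.
  have := sqr_ge0 (2 * (z p.2 - z p.1) - b); nra.
rewrite big_split /= -mulr_sumr sum_swappable_cst.
have := swap_poincare S z; have := adjR_contract (y S).
rewrite -!/(irregularity S) -/(z _) => c1 c2.
have c3 : #|V|%:R * \sum_v z v ^+ 2 <= #|V|%:R * (k%:R ^+ 2 * irregularity S).
  by rewrite ler_wpM2l.
have := sqr_ge0 (k%:R * (#|V|%:R - 2 * #|S|%:R) : R); nra.
Qed.

(** The increment of the cut size along [(u, v)] is twice the difference of the
neighbour counts, up to the correction when [u] and [v] are adjacent, which
occurs for as many moves as there are cut edges. *)
Lemma sum_sqr_cut_size_swap S :
  \sum_(p | swappable S p) ((cut_size G S)%:R - (cut_size G (swap S p))%:R) ^+ 2 <=
  8 * #|V|%:R * irregularity S + 8 * #|V|%:R * k%:R.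
Proof.
apply: (@le_trans _ _ (\sum_(p | swappable S p)
    (8 * (y S p.2 - y S p.1) ^+ 2 + 8 * adjR p.1 p.2))).
  apply: ler_sum => p H; rewrite cut_size_swap//.
  have e := adjR_sqr p.1 p.2; rewrite -{2}e /y.
  have := sqr_ge0 (nbr_count S p.2 - nbr_count S p.1 + adjR p.1 p.2); nra.
rewrite big_split /= -!mulr_sumr -cut_size_sum.
have := cut_size_le S; have := swap_poincare S (y S); rewrite -/(irregularity S).
nra.
Qed.

End Cut.

(** * Moment generating functions *)

Section Concentration.
Context {R : realType} {V : finType} (G : sgraph V) (k l : nat).
Hypotheses (regG : regular G k) (k0 : (0 < k)%N) (V0 : (0 < #|V|)%N).
Hypothesis lV : (l <= #|V|)%N.
Local Notation E := (@expect_subset R V l).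
Local Notation n := (#|V|%:R : R).
Local Notation irr := (@irregularity R V G k).

Lemma regular_degree_lt : (k < #|V|)%N.
Proof.
have /card_gt0P[v _] := V0.
rewrite -(regG v) -cardsT; apply: proper_card; apply/properP; split.
  exact: finset.subsetT.
by exists v; rewrite ?inE// adj_irr.
Qed.

(** At the scale [c = 1 / (4 n k)] the self-bounding term is [k D], where [D] is
[E (g exp (c g))]; as [k <= n], it is at most half of the drift term [2 n D]
and can be absorbed in it. *)
Lemma ln_mgf_irregularity_le :
  ln (E (fun S => expR ((4 * n * k%:R)^-1 * irr S))) <= 5 / 16.
Proof.
set c := (4 * n * k%:R)^-1; pose X S := c * irr S.
have n0 : 0 < n by rewrite ltr0n.
have kp : 0 < k%:R :> R by rewrite ltr0n.
have c0 : 0 < c by rewrite invr_gt0 !mulr_gt0.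
have kn : k%:R <= n by rewrite ler_nat ltnW// regular_degree_lt.
have cE : c * (4 * n * k%:R) = 1 by rewrite mulVf// gt_eqF// !mulr_gt0.
set M := E _; pose D := E (fun S => irr S * expR (X S)).
have M0 : 0 < M by apply: expect_gt0 => // S; exact: expR_gt0.
have D0 : 0 <= D.
  rewrite -(expect_cst lV 0); apply: le_expect => S _.
  by rewrite mulr_ge0 ?irregularity_ge0 ?expR_ge0.
have lower : c * (2 * n * D - n ^+ 2 * k%:R * M) <= E (fun S => \sum_(p | swappable S p)
     (X S - X (swap S p)) * expR (X S)).
  have -> : 2 * n * D - n ^+ 2 * k%:R * M =
      E (fun S => 2 * n * (irr S * expR (X S)) + - (n ^+ 2 * k%:R) * expR (X S)).
    by rewrite expectD !expectZ mulNr.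
  rewrite -expectZ; apply: le_expect => S _.
  rewrite -mulr_suml (eq_bigr (fun p => c * (irr S - irr (swap S p)))); last first.
    by move=> p _; rewrite /X; ring.
  rewrite -mulr_sumr -[leRHS]mulrA.
  rewrite ler_pM2l//.
  have H := sum_irregularity_swap (R := R) regG V0 S.
  rewrite -(ler_pM2r (expR_gt0 (X S))) in H; lra.
have upper : E (fun S => expR (X S) * \sum_(p | swappable S p)
     (X S - X (swap S p)) ^+ 2) <=
     c ^+ 2 * (8 * n * k%:R ^+ 2 * D + 2 * n ^+ 2 * k%:R ^+ 2 * M).
  have -> : 8 * n * k%:R ^+ 2 * D + 2 * n ^+ 2 * k%:R ^+ 2 * M =
      E (fun S => 8 * n * k%:R ^+ 2 * (irr S * expR (X S))
         + 2 * n ^+ 2 * k%:R ^+ 2 * expR (X S)).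
    by rewrite expectD !expectZ.
  rewrite -expectZ; apply: le_expect => S _.
  rewrite (eq_bigr (fun p => c ^+ 2 * (irr S - irr (swap S p)) ^+ 2)); last first.
    by move=> p _; rewrite /X; ring.
  rewrite -mulr_sumr mulrCA ler_pM2l ?exprn_gt0//.
  have H := sum_sqr_irregularity_swap (R := R) regG S.
  rewrite -(ler_pM2r (expR_gt0 (X S))) in H; lra.
have DM : D <= 5 / 4 * n * k%:R * M.
  have half : 0 <= 2^-1 :> R by rewrite invr_ge0.
  have := le_trans lower (le_trans (dirichlet_le l X) (ler_wpM2r half upper)).
  have -> : c ^+ 2 * (8 * n * k%:R ^+ 2 * D + 2 * n ^+ 2 * k%:R ^+ 2 * M) / 2 =
    c * (c * (4 * n * k%:R)) * (k%:R * D + n * k%:R * M / 4) by field.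
  rewrite cE mulr1 ler_pM2l// => H.
  have n1 : 1 <= n by rewrite ler1n.
  have nD : n * D <= n * ((n * k%:R + k%:R / 4) * M).
    have : k%:R * D <= n * D by rewrite ler_wpM2r.
    lra.
  move: nD; rewrite ler_pM2l// => nD; apply: (le_trans nD).
  rewrite ler_wpM2r ?(ltW M0)//; nra.
apply: le_trans (ln_mgf_le lV X) _; rewrite ler_pdivrMr//.
have -> : E (fun S => X S * expR (X S)) = c * D.
  by rewrite -expectZ; apply: eq_expect => S _; rewrite /X mulrA.
have -> : 5 / 16 * M = c * (5 / 4 * n * k%:R * M).
  by transitivity (5 / 16 * (c * (4 * n * k%:R)) * M); [rewrite cE; ring|field].
by rewrite ler_pM2l.
Qed.

(** The affine drift of [sum_cut_size_swap] has expectation zero by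
reversibility, and this identifies its constant term with [E T]. *)
Lemma expect_cut_size_eigen (S : {set V}) : #|S| = l ->
  let T (S : {set V}) := (cut_size G S)%:R : R in
  \sum_(p | swappable S p) (T S - T (swap S p)) = 2 * (n - 1) * (T S - E T).
Proof.
move=> Sl T; rewrite (sum_cut_size_swap regG) Sl -/(T S).
pose a : R := (n - l%:R) * k%:R * l%:R.
suff : a = (n - 1) * E T by rewrite /a; lra.
have : E (fun S => \sum_(p | swappable S p) (T S - T (swap S p))) = 0.
  have -> : E (fun S => \sum_(p | swappable S p) (T S - T (swap S p))) =
      E (fun S => \sum_(p | swappable S p) T S
            + -1 * \sum_(p | swappable S p) T (swap S p)).
    by apply: eq_expect => S' _; rewrite sumrB mulN1r.
  rewrite expectD expectZ (expect_swap_sym l (fun S S' => T S)); ring.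
rewrite (eq_expect (Y := fun S => 2 * (n - 1) * T S + - 2 * a)); last first.
  by move=> S' S'l; rewrite (sum_cut_size_swap regG) S'l /a /T; ring.
by rewrite expectD expectZ (expect_cst lV); lra.
Qed.

(** The bound on [E (g expR h)] given by [gibbs] contains [D] itself; moving this
term to the left produces the factor [1 - 16 n k gamma ^ 2]. *)
Lemma ln_mgf_cut_size_le (gamma : R) :
  let T (S : {set V}) := (cut_size G S)%:R : R in
  16 * n * k%:R * gamma ^+ 2 < 1 ->
  ln (E (fun S => expR (gamma * (T S - E T)))) <=
  7 * n * k%:R * gamma ^+ 2 / (1 - 16 * n * k%:R * gamma ^+ 2).
Proof.
move=> T small; pose h S := gamma * (T S - E T); pose c : R := (4 * n * k%:R)^-1.
have n2 : 2 <= n by rewrite (ler_nat _ 2%N); exact: leq_ltn_trans k0 regular_degree_lt.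
have kp : 0 < k%:R :> R by rewrite ltr0n.
have n0 : 0 < n by rewrite ltr0n.
set m := E _; pose D := E (fun S => h S * expR (h S)).
pose B := E (fun S => expR (h S) * irr S).
have m0 : 0 < m by apply: expect_gt0 => // S; exact: expR_gt0.
have lnm0 : 0 <= ln m.
  apply: (ln_mgf_ge0 lV (X := h)); rewrite expectZ expectD (expect_cst lV); ring.
have lnmD : ln m <= D / m := ln_mgf_le lV h.
have D0 : 0 <= D.
  by have := le_trans lnm0 lnmD; rewrite pmulr_lge0 ?invr_gt0.
have BD : B <= 5 / 4 * n * k%:R * m + 4 * n * k%:R * D.
  have := gibbs lV h (fun S => c * irr S); rewrite -/m -/D.
  have -> : E (fun S => expR (h S) * (c * irr S)) = c * B.
    by rewrite -expectZ; apply: eq_expect => S _; rewrite mulrCA.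
  move=> H; have {}H : c * B <= m * (5 / 16) + D.
    apply: le_trans H _; rewrite lerD2r ler_pM2l//.
    by have := ln_mgf_irregularity_le; rewrite -/c; lra.
  move: H; rewrite mulrC ler_pdivrMr ?mulr_gt0//; lra.
have DB : 2 * (n - 1) * D <= gamma ^+ 2 * (4 * n * B + 4 * n * k%:R * m).
  have -> : 2 * (n - 1) * D = E (fun S => \sum_(p | swappable S p)
      (h S - h (swap S p)) * expR (h S)).
    rewrite -expectZ; apply: eq_expect => S Sl; rewrite -mulr_suml.
    have -> : \sum_(p | swappable S p) (h S - h (swap S p)) =
       gamma * \sum_(p | swappable S p) (T S - T (swap S p)).
      by rewrite mulr_sumr; apply: eq_bigr => p _; rewrite /h; ring.
    by rewrite (expect_cut_size_eigen Sl) /h; ring.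
  apply: le_trans (dirichlet_le l h) _; rewrite ler_pdivrMr//.
  have -> : gamma ^+ 2 * (4 * n * B + 4 * n * k%:R * m) * 2 =
     E (fun S => gamma ^+ 2 * (8 * n * (expR (h S) * irr S)
         + 8 * n * k%:R * expR (h S))).
    by rewrite expectZ expectD !expectZ -/B -/m; ring.
  apply: le_expect => S _.
  rewrite (eq_bigr (fun p => gamma ^+ 2 * (T S - T (swap S p)) ^+ 2)); last first.
    by move=> p _; rewrite /h; ring.
  rewrite -mulr_sumr mulrCA ler_wpM2l ?sqr_ge0//.
  have H := sum_sqr_cut_size_swap (R := R) regG S.
  rewrite -(ler_pM2r (expR_gt0 (h S))) in H; rewrite /T; lra.
have Dm : D * (1 - 16 * n * k%:R * gamma ^+ 2) <= 7 * n * k%:R * gamma ^+ 2 * m.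
  have g0 := sqr_ge0 gamma.
  have H1 : n * D <= 2 * (n - 1) * D by rewrite ler_wpM2r//; lra.
  have H2 : gamma ^+ 2 * (4 * n * B + 4 * n * k%:R * m) <=
     n * (gamma ^+ 2 * (4 * (5 / 4 * n * k%:R * m + 4 * n * k%:R * D) + 2 * n * k%:R * m)).
    rewrite [leRHS]mulrCA; apply: ler_wpM2l => //.
    have H3 : n * B <= n * (5 / 4 * n * k%:R * m + 4 * n * k%:R * D).
      by apply: ler_wpM2l BD; exact: ltW.
    have H4 : n * (2 * (k%:R * m)) <= n * (n * (k%:R * m)).
      apply: ler_wpM2l; first exact: ltW.
      by apply: ler_wpM2r n2; rewrite mulr_ge0// ltW.
    lra.
  have := le_trans H1 (le_trans DB H2); rewrite ler_pM2l//; lra.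
apply: (le_trans lnmD); rewrite ler_pdivrMr// mulrAC ler_pdivlMr//; lra.
Qed.

End Concentration.

Theorem mainTheorem5 (R : realType) (d : nat -> nat)
  (hd : (fun n : nat => (d n)%:R : R) =o_\oo (fun n : nat => n%:R : R)) :
  exists eps1 eps2 eps3 : nat -> R,
    [/\ eps1 n @[n --> \oo] --> (0 : R),
        eps2 n @[n --> \oo] --> (0 : R),
        eps3 n @[n --> \oo] --> (0 : R)
      & forall (n : nat) (V : finType) (G : sgraph V) (l : nat) (gamma : R),
          #|V| = n -> regular G (d n) -> (l <= n)%N ->
          2 * `|gamma| * Num.sqrt (4 * n%:R * (d n)%:R * (1 + eps1 n)) < 1 ->
          let T : {set V} -> R := fun S => (cut_size G S)%:R in
          let ET : R := expect_subset l T in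
          ln (expect_subset l (fun S => expR (gamma * (T S - ET))))
            <= (32 * n%:R * (d n)%:R * gamma ^+ 2 * (1 + eps2 n))
               / (1 - 16 * n%:R * (d n)%:R * gamma ^+ 2 * (1 + eps3 n))].
Proof.
exists (fun=> 0), (fun=> 0), (fun=> 0); split; try exact: cvg_cst.
move=> n V G l gamma <- {n} regG lV; rewrite !(addr0, mulr1) => hgamma.
cbv zeta; set T := fun S => _%:R; set ET := expect_subset l T.
have small : 16 * #|V|%:R * (d #|V|)%:R * gamma ^+ 2 < 1.
  have y0 : 0 <= 4 * #|V|%:R * (d #|V|)%:R :> R by rewrite !mulr_ge0.
  have : (2 * `|gamma| * Num.sqrt (4 * #|V|%:R * (d #|V|)%:R)) ^+ 2 < 1.
    by rewrite expr_lt1// !mulr_ge0// sqrtr_ge0.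
  rewrite !exprMn sqr_sqrtr// real_normK ?num_real//; lra.
have x0 : 0 <= #|V|%:R * (d #|V|)%:R * gamma ^+ 2.
  by apply: mulr_ge0 (sqr_ge0 gamma); rewrite mulr_ge0.
(* Without edges or without vertices, the cut size is constantly zero. *)
have [z|] := eqVneq (#|V| * d #|V|)%N 0%N.
  have T0 S : T S = 0.
    apply/eqP; rewrite eq_le ler0n andbT; have := @cut_size_le R V G (d #|V|) regG S.
    by rewrite -natrM z.
  have -> : expect_subset l (fun S => expR (gamma * (T S - ET))) = 1.
    rewrite -[RHS](expect1 lV); apply: eq_expect => S _.
    have -> : ET = 0 by rewrite /ET -(expect_cst lV 0); apply: eq_expect.
    by rewrite T0 subrr mulr0 expR0.
  by rewrite ln1 divr_ge0 ?subr_ge0 ?(ltW small)//; lra.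
rewrite muln_eq0 negb_or -!lt0n => /andP[V0 d0].
apply: le_trans (ln_mgf_cut_size_le regG d0 V0 lV small) _.
rewrite ler_pM2r ?invr_gt0 ?subr_gt0//.
lra.
Qed.
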